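(* Let $M\subset\mathbb{R}^n$ be a bounded, closed and convex set that is invariant $\varphi$-minimal. Then for any $a\in\mathbb{R}^n$ and any $w\in\mathbb{R}^n_{>0}$ there exists an element $x_{a,w}\in M$ such that $$\sum_{i=1}^n w_i\,\varphi\Big(\frac{a_i-x_{a,w,i}}{w_i}\Big)\le\sum_{i=1}^n w_i\,\varphi\Big(\frac{a_i-x_i}{w_i}\Big)$$ holds for all $x\in M$ and all convex functions $\varphi:\mathbb{R}\to\mathbb{R}$.
   Context: A set $M\subset\mathbb{R}^n$ is called invariant $\varphi$-minimal if for any $a\in\mathbb{R}^n$ there exists an element $x_a\in M$ such that $\sum_{i=1}^n\varphi(a_i-x_{a,i})\le\sum_{i=1}^n\varphi(a_i-x_i)$ holds for all $x\in M$ and all convex functions $\varphi:\mathbb{R}\to\mathbb{R}$ (so $x_a$ depends on $a$ but not on $\varphi$ or $x$). Likewise $x_{a,w}$ in the claim depends only on $a$ and $w$; $x_{a,w,i}$ denotes its $i$-th coordinate. $\mathbb{R}^n_{>0}$ is the set of vectors with all coordinates positive. *)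

(* Defs.v *)
From HB Require Import structures.
From mathcomp Require Import all_boot all_order all_algebra.
From mathcomp Require Import all_classical all_reals all_analysis.

Set Implicit Arguments.
Unset Strict Implicit.
Unset Printing Implicit Defensive.

Import Order.TTheory GRing.Theory Num.Theory.
Import numFieldNormedType.Exports.

Local Open Scope classical_set_scope.
Local Open Scope ring_scope.

(* [xa] is quantified before [phi] and [x]: a single point of [M] must be
   optimal for all convex functions simultaneously. *)
Definition invariant_phi_minimal (R : realType) (n : nat)
    (M : set 'rV[R]_n) : Prop :=
  forall a : 'rV[R]_n, exists2 xa : 'rV[R]_n, M xa &
    forall x : 'rV[R]_n, M x ->
    forall phi : R -> R, convex_function setT phi ->
      \sum_(i < n) phi (a ord0 i - xa ord0 i)
        <= \sum_(i < n) phi (a ord0 i - x ord0 i).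

(* Main.v *)
(** Let [x] minimise the strictly convex [sum_i (a_i - x_i)^2 / w_i] over [M]
    and put [u_i = (a_i - x_i) / w_i].  The first-order condition
    [sum_i u_i (y_i - x_i) <= 0] for all [y] in [M] says precisely that [x] is
    the Euclidean projection of [x + u] onto [M].  Invariant minimality applied
    to [x + u], tested on the square function, therefore selects [x] itself, so
    [sum_i phi (u_i) <= sum_i phi (x_i + u_i - y_i)] for all convex [phi].
    Using this at [x + s (y - x)] with [s] so small that [s w_i <= 1] for all
    [i], convexity of [phi] along [u_i - s (y_i - x_i) =
    (1 - s w_i) u_i + s w_i (a_i - y_i) / w_i] reintroduces the weights and gives
    the weighted inequality multiplied by [s]. *)
Require Import Defs.
From HB Require Import structures.
From mathcomp Require Import all_boot all_order all_algebra.
From mathcomp Require Import all_classical all_reals all_analysis.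
From mathcomp Require Import ring lra.

Import Order.TTheory GRing.Theory Num.Theory.
Import numFieldNormedType.Exports.

Local Open Scope classical_set_scope.
Local Open Scope ring_scope.

Lemma convex_set_segment {R : realType} {V : lmodType R} {M : set V} {x y : V}
    {s : R} :
  convex_set M -> M x -> M y -> 0 <= s -> s <= 1 -> M (x + s *: (y - x)).
Proof.
move=> cM Mx My s0 s1.
have := cM y x (Itv01 s0 s1) (mem_set My) (mem_set Mx).
rewrite inE; congr (M _).
by rewrite /conv /= scalerBl scale1r scalerBr addrCA.
Qed.

Lemma convex_function_segment {R : realType} {phi : R -> R} (x y : R) {s : R} :
  convex_function setT phi -> 0 <= s -> s <= 1 ->
  phi (x + s * (y - x)) <= phi x + s * (phi y - phi x).
Proof.
move=> cphi s0 s1.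
have := cphi (Itv01 s0 s1) y x (in_setT _) (in_setT _).
rewrite [X in _ <= X]convRE /conv /= /unstable.onem /GRing.scale /=.
by congr (_ <= _); [congr phi|]; ring.
Qed.

Lemma convex_function_sqr (R : realType) :
  convex_function setT (fun x : R => x ^+ 2).
Proof.
move=> t x y _ _.
rewrite [X in _ <= X]convRE /conv /= /unstable.onem /GRing.scale /=.
have t0 : 0 <= t%:num by [].
have t1 : t%:num <= 1 by [].
rewrite -subr_ge0.
set s := t%:num in t0 t1 *.
rewrite (_ : _ - _ = s * (1 - s) * (x - y) ^+ 2); last by ring.
by rewrite mulr_ge0 ?sqr_ge0 // mulr_ge0 // subr_ge0.
Qed.

(** This stands in for letting [s] tend to 0. If [A] were positive, [s = 1] would force [B > 0], and
    then [s = A / (A + B)] would give [A + B <= B]. *)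
Lemma le0_of_le_small {R : realFieldType} (A B : R) :
  (forall s, 0 < s -> s <= 1 -> A <= s * B) -> A <= 0.
Proof.
move=> h; rewrite leNgt; apply/negP => A0.
have B0 : 0 < B by apply: lt_le_trans A0 _; rewrite -[B]mul1r; exact: h.
have c0 : 0 < A + B by rewrite addr_gt0.
have := h (A / (A + B)) (divr_gt0 A0 c0).
rewrite ler_pdivrMr // mul1r lerDl ltW // => /(_ isT).
rewrite mulrAC ler_pdivlMr // ler_pM2l //; lra.
Qed.

Lemma weighted_projection {R : realType} {n : nat} {M : set 'rV[R]_n}
    (a w : 'rV[R]_n) :
  M !=set0 -> compact M -> convex_set M ->
  exists2 x : 'rV[R]_n, M x &
    forall y, M y ->
      \sum_(i < n) (a ord0 i - x ord0 i) / w ord0 i * (y ord0 i - x ord0 i)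
        <= 0.
Proof.
move=> M0 Mcompact Mconvex.
pose f (x : 'rV[R]_n) := \sum_(i < n) (a ord0 i - x ord0 i) ^+ 2 / w ord0 i.
have fcont : continuous f.
  have fi i :
      continuous (fun x : 'rV[R]_n => (a ord0 i - x ord0 i) ^+ 2 / w ord0 i).
    move=> x.
    have ca : (fun=> a ord0 i) @ x --> a ord0 i by apply: cst_continuous.
    have cx : y ord0 i @[y --> x] --> x ord0 i by apply: coord_continuous.
    exact: cvgMr_tmp (cvgM (cvgB ca cx) (cvgB ca cx)).
  exact: (continuous_big (@add_continuous _) (fun i _ => fi i)).
have [x Mx xmin] := EVT_min_rV M0 Mcompact (continuous_subspaceT fcont).
rewrite inE in Mx; exists x => // y My.
(* The factor 2 comes from expanding the squares: with [A] the sum in the goal and [B] the sum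
   supplied below, [f (x + s *: (y - x)) - f x = s * (s * B - 2 * A)]. *)
rewrite -(@pmulr_rle0 _ 2) //.
apply: (le0_of_le_small _
  (\sum_(i < n) (y ord0 i - x ord0 i) ^+ 2 / w ord0 i)) => s s0 s1.
have := xmin _ (mem_set (convex_set_segment Mconvex Mx My (ltW s0) s1)).
rewrite -subr_ge0 => h; rewrite -subr_ge0 -(pmulr_rge0 _ s0); move: h.
congr (0 <= _).
rewrite /f mulrBr !mulr_sumr -!sumrB; apply: eq_bigr => i _.
by rewrite !mxE; ring.
Qed.

Lemma variational_minimal {R : realType} {n : nat} {M : set 'rV[R]_n}
    {x u : 'rV[R]_n} :
  invariant_phi_minimal M -> M x ->
  (forall y, M y -> \sum_(i < n) u ord0 i * (y ord0 i - x ord0 i) <= 0) ->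
  forall y, M y -> forall phi : R -> R, convex_function setT phi ->
    \sum_(i < n) phi (u ord0 i)
      <= \sum_(i < n) phi (u ord0 i - (y ord0 i - x ord0 i)).
Proof.
move=> Mmin Mx xu.
have [z Mz zmin] := Mmin (x + u).
(* Testing [z] against [x] on squares gives [sum_i (z_i - x_i)^2 <= 2 * S], while [xu] at [z] gives
   [S <= 0]. *)
have zx i : z ord0 i - x ord0 i = 0.
  have := zmin x Mx _ (convex_function_sqr R).
  have := xu z Mz; set S := \sum_i _ => S0.
  rewrite -subr_ge0 -sumrB.
  rewrite (eq_bigr (fun i => 2 * (u ord0 i * (z ord0 i - x ord0 i))
                              - (z ord0 i - x ord0 i) ^+ 2)); last first.
    by move=> j _; rewrite !mxE; ring.
  rewrite sumrB -mulr_sumr -/S => h.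
  have /eqP : \sum_(i < n) (z ord0 i - x ord0 i) ^+ 2 = 0.
    apply/eqP; rewrite eq_le sumr_ge0 ?andbT; last by move=> *; exact: sqr_ge0.
    lra.
  rewrite psumr_eq0; last by move=> *; exact: sqr_ge0.
  by move=> /allP /(_ i (mem_index_enum _)) /=; rewrite sqrf_eq0 => /eqP.
move=> y My phi cphi; have := zmin y My phi cphi.
congr (_ <= _); apply: eq_bigr => i _; congr phi; rewrite mxE.
- by have := zx i; lra.
- by ring.
Qed.

Theorem theorem6p2 (R : realType) (n : nat) (M : set 'rV[R]_n)
    (Mbounded : bounded_set M) (Mclosed : closed M) (Mconvex : convex_set M)
    (Mmin : invariant_phi_minimal M)
    (a w : 'rV[R]_n) (w_gt0 : forall i : 'I_n, 0 < w ord0 i) :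
  exists2 xaw : 'rV[R]_n, M xaw &
    forall x : 'rV[R]_n, M x ->
    forall phi : R -> R, convex_function setT phi ->
      \sum_(i < n) w ord0 i * phi ((a ord0 i - xaw ord0 i) / w ord0 i)
        <= \sum_(i < n) w ord0 i * phi ((a ord0 i - x ord0 i) / w ord0 i).
Proof.
have M0 : M !=set0 by have [z Mz _] := Mmin 0; exists z.
have [x Mx xu] := weighted_projection a w M0
  (bounded_closed_compact Mbounded Mclosed) Mconvex.
exists x => // y My phi cphi.
pose u : 'rV[R]_n := \row_i ((a ord0 i - x ord0 i) / w ord0 i).
have {}xu z (Mz : M z) : \sum_(i < n) u ord0 i * (z ord0 i - x ord0 i) <= 0.
  by under eq_bigr do rewrite mxE; exact: xu.
(* The step length is [W^-1]: the summand 1 keeps the moved point on the segment inside [M], and the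
   sum of the weights ensures [W^-1 * w_i <= 1] for every [i]. *)
pose W := 1 + \sum_(i < n) w ord0 i.
have W1 : 1 <= W by rewrite lerDl sumr_ge0 // => i _; exact: ltW.
have W0 : 0 < W := lt_le_trans ltr01 W1.
have wW i : w ord0 i <= W.
  rewrite /W (bigD1 i) //= addrCA lerDl addr_ge0 // sumr_ge0 // => j _.
  exact: ltW.
have Wi0 : 0 < W^-1 by rewrite invr_gt0.
have Wi1 : W^-1 <= 1 by rewrite invf_le1.
have := variational_minimal Mmin Mx xu _
  (convex_set_segment Mconvex Mx My (ltW Wi0) Wi1) _ cphi.
rewrite -subr_ge0 -sumrB => h.
rewrite -subr_ge0 -sumrB -(pmulr_rge0 _ Wi0) mulr_sumr.
(* The comparison now holds term by term: each one is convexity of [phi] between [u_i] and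
   [(a_i - y_i) / w_i] with parameter [W^-1 * w_i]. *)
apply: le_trans h _; apply: ler_sum => i _.
have wi0 : w ord0 i != 0 by rewrite gt_eqF.
rewrite -mulrBr mulrA lerBlDl !mxE.
have sw1 : W^-1 * w ord0 i <= 1 by rewrite mulrC ler_pdivrMr // mul1r.
have := convex_function_segment ((a ord0 i - x ord0 i) / w ord0 i)
  ((a ord0 i - y ord0 i) / w ord0 i) cphi
  (mulr_ge0 (ltW Wi0) (ltW (w_gt0 i))) sw1.
congr (_ <= _); congr phi.
by field; rewrite wi0 gt_eqF.
Qed.
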